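(* Let $\succeq$ and $\prec$ be two binary relations on $\mathcal{L}$. There exists a model without confusion $\mathcal{M}\in\mathbb{M}$ with $0\in\mathcal{M}_{\mathrm{acc}}$ such that, for all $f,g\in\mathcal{L}$, $f\succeq g\Leftrightarrow f-g\in\mathcal{M}_{\mathrm{acc}}$ and $f\prec g\Leftrightarrow f-g\in\mathcal{M}_{\mathrm{rej}}$, if and only if for all $f,g,h\in\mathcal{L}$ and all real $0<\mu\leq1$: (AD1) Accept Reflexivity: $f\succeq f$; (AD2) Reject Irreflexivity: not $f\prec f$; (AD3) Accept Transitivity: if $f\succeq g$ and $g\succeq h$, then $f\succeq h$; (AD4) Mixed Transitivity: if $f\prec g$ and $h\succeq g$, then $f\prec h$; (AD5) Accept Mixture Independence: $f\succeq g$ if and only if $\mu f+(1-\mu)h\succeq\mu g+(1-\mu)h$; (AD6) Reject Mixture Independence: $f\prec g$ if and only if $\mu f+(1-\mu)h\prec\mu g+(1-\mu)h$.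
   Context: Let $\Omega$ be a non-empty set and let $\mathcal{L}$ be a real linear subspace of the vector space of all real-valued functions (''gambles'') on $\Omega$ with pointwise operations. The relations $\succeq$ and $\prec$ are unrelated a priori ($\prec$ is not assumed to be the strict part of the converse of $\succeq$). For $\mathcal{K},\mathcal{K}'\subseteq\mathcal{L}$: $\mathcal{K}-\mathcal{K}'=\{f-g:f\in\mathcal{K},g\in\mathcal{K}'\}$ (empty if either set is empty); $\overline{\mathcal{K}}=\{\lambda f:\lambda>0,f\in\mathcal{K}\}$; $\operatorname{posi}\mathcal{K}$ is the set of all linear combinations with strictly positive coefficients of non-empty finite families of elements of $\mathcal{K}$ (so $\operatorname{posi}\emptyset=\emptyset$). A cone is a set $\mathcal{K}\subseteq\mathcal{L}$ with $\operatorname{posi}\mathcal{K}=\mathcal{K}$. An assessment is a pair $\mathcal{A}=\langle\mathcal{A}_{\mathrm{acc}};\mathcal{A}_{\mathrm{rej}}\rangle$ of subsets of $\mathcal{L}$. A model without confusion is an assessment $\mathcal{M}$ such that $\mathcal{M}_{\mathrm{acc}}\cap\mathcal{M}_{\mathrm{rej}}=\emptyset$, $\mathcal{M}_{\mathrm{acc}}$ is a cone, and $\overline{\mathcal{M}_{\mathrm{rej}}}\cup(\overline{\mathcal{M}_{\mathrm{rej}}}-\mathcal{M}_{\mathrm{acc}})\subseteq\mathcal{M}_{\mathrm{rej}}$. The set of these is $\mathbb{M}$. *)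

(* Defs.v *)
From HB Require Import structures.
From mathcomp Require Import all_boot all_order all_algebra.
From mathcomp Require Import boolp classical_sets functions reals.

Set Implicit Arguments.
Unset Strict Implicit.
Unset Printing Implicit Defensive.

Import Order.TTheory GRing.Theory Num.Theory.
Local Open Scope classical_set_scope.
Local Open Scope ring_scope.

(* [L] bundles an arbitrary linear subspace of the pointwise vector space of
   functions [Omega -> R]; the codomain is written [R^o] because it is [R] seen
   as a vector space over itself. *)
Section Gambles.
Variables (R : realType) (Omega : Type) (L : submodClosed (Omega -> R^o)).

Definition gamble : Type := {f : Omega -> R^o | f \in L}.

HB.instance Definition _ := SubChoice.on gamble.
HB.instance Definition _ := [SubChoice_isSubLmodule of gamble by <:].

End Gambles.

Section Assessments.
Variables (R : realType) (V : lmodType R).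
Implicit Types K : set V.

Definition set_sub K K' : set V := [set f - g | f in K & g in K'].

Definition scaling_hull K : set V :=
  [set h | exists (a : R) (f : V), [/\ 0 < a, K f & h = a *: f]].

(* ['I_n.+1] indexes the family, so that it is non-empty. *)
Definition posi K : set V :=
  [set h | exists (n : nat) (a : 'I_n.+1 -> R) (f : 'I_n.+1 -> V),
    [/\ forall i, 0 < a i, forall i, K (f i) & h = \sum_i a i *: f i]].

Definition cone K : Prop := posi K = K.

Record assessment := Assessment { acc : set V; rej : set V }.

Definition model_without_confusion (M : assessment) : Prop :=
  [/\ acc M `&` rej M = set0,
      cone (acc M) &
      scaling_hull (rej M) `|` set_sub (scaling_hull (rej M)) (acc M)
        `<=` rej M].

End Assessments.

(* Main.v *)
Require Import Defs.
From mathcomp Require Import all_boot all_order all_algebra.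
From mathcomp Require Import boolp classical_sets functions reals.

(** Only the vector-space structure matters, so everything is done in an
    arbitrary real vector space.

    A relation [r] satisfying mixture independence is the same thing as a set
    [K] closed under multiplication by positive scalars, through
    [r f g <-> K (f - g)].  From [K] to [r]: the difference of the two mixtures
    is [mu *: (f - g)] ([mixture_independent_diff]).  From [r] to
    [K = [set v | r v 0]]: mixing with [0] gives invariance under scaling
    ([mixture_independent_scale]), and mixing [f] and [g] with [- g], with equal
    weights, gives translation invariance ([mixture_independent_subr0]).

    Under this correspondence, transitivity of acceptance is closure of the
    accepted set under addition, which together with positive scaling says that
    it is a cone ([coneP]); mixed transitivity says that subtracting an accepted
    gamble from a rejected one leaves it rejected; and irreflexivity of
    rejection, given that [0] is accepted, says that no gamble is both accepted
    and rejected. *)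

Local Open Scope classical_set_scope.
Local Open Scope ring_scope.

Import Order.TTheory GRing.Theory Num.Theory.

Section VectorSpace.
Context {R : realType} {V : lmodType R}.
Implicit Types (K : set V) (r : V -> V -> Prop).

(** Stable under multiplication by strictly positive scalars; nothing is asked of
    the scalar [0], so that [K] need not contain the origin. *)
Definition pos_scaling_closed K : Prop :=
  forall (a : R) v, 0 < a -> K v -> K (a *: v).

(** The empty set satisfies both sides. *)
Lemma coneP K :
  cone K <-> (forall u v, K u -> K v -> K (u + v)) /\ pos_scaling_closed K.
Proof.
split=> [coneK|[addK scaleK]].
  split=> [u v Ku Kv|a v a0 Kv]; rewrite -coneK.
    exists 1%N, (fun=> 1), (fun i => if i == ord0 then u else v).
    split=> // [i|]; first by case: ifP.
    by rewrite big_ord_recl big_ord1 !scale1r.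
  by exists 0%N, (fun=> a), (fun=> v); split=> //; rewrite big_ord1.
apply/seteqP; split=> [_ [n [a [f [a0 Kf ->]]]]|v Kv]; last first.
  by exists 0%N, (fun=> 1), (fun=> v); split=> //; rewrite big_ord1 scale1r.
elim: n a f a0 Kf => [|n IHn] a f a0 Kf.
  by rewrite big_ord1; apply: scaleK.
rewrite big_ord_recl; apply: addK; first exact: scaleK.
by apply: (IHn (fun i => a (lift ord0 i)) (fun i => f (lift ord0 i))).
Qed.

(** The condition common to (AD5) and (AD6). *)
Definition mixture_independent r : Prop :=
  forall (f g h : V) (mu : R), 0 < mu -> mu <= 1 ->
    r f g <-> r (mu *: f + (1 - mu) *: h) (mu *: g + (1 - mu) *: h).

Lemma mixture_independent_diff K r :
  pos_scaling_closed K -> (forall f g, r f g <-> K (f - g)) ->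
  mixture_independent r.
Proof.
move=> scaleK rK f g h mu mu0 _.
rewrite !rK opprD addrACA subrr addr0 -scalerBr; split=> [|Kmu]; first exact: scaleK.
have := scaleK mu^-1 _ _ Kmu; rewrite invr_gt0 => /(_ mu0).
by rewrite scalerA mulVf ?scale1r // gt_eqF.
Qed.

Lemma mixture_independent_scale r (a : R) v :
  mixture_independent r -> 0 < a -> r v 0 <-> r (a *: v) 0.
Proof.
move=> rmix.
have le1 (b : R) w : 0 < b -> b <= 1 -> r w 0 <-> r (b *: w) 0.
  by move=> b0 b1; have := rmix w 0 0 b b0 b1; rewrite !scaler0 !addr0.
move=> a0; have [a1|/ltW a1] := leP a 1; first exact: le1.
(* A factor above 1 is undone by its inverse, which is at most 1. *)
have := le1 a^-1 (a *: v); rewrite invr_gt0 invf_le1 // => /(_ a0 a1).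
by rewrite scalerA mulVf ?scale1r ?gt_eqF // => h; apply: iff_sym.
Qed.

Lemma mixture_independent_subr0 r f g :
  mixture_independent r -> r f g <-> r (f - g) 0.
Proof.
move=> rmix.
have half0 : 0 < 2^-1 :> R by rewrite invr_gt0 ltr0n.
have half1 : 2^-1 <= 1 :> R by rewrite invf_le1 ?ltr0n // ler1n.
have halfC : 1 - 2^-1 = 2^-1 :> R by rewrite {1}[1](splitr 1) div1r addrK.
have := rmix f g (- g) _ half0 half1.
rewrite halfC -!scalerDr subrr scaler0 => ->.
by apply: iff_sym; apply: mixture_independent_scale.
Qed.

Lemma model_axioms (M : assessment V) (succeq prec : V -> V -> Prop) :
  model_without_confusion M -> acc M 0 ->
  (forall f g, succeq f g <-> acc M (f - g)) ->
  (forall f g, prec f g <-> rej M (f - g)) ->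
  [/\ forall f, succeq f f,
      forall f, ~ prec f f,
      forall f g h, succeq f g -> succeq g h -> succeq f h,
      forall f g h, prec f g -> succeq h g -> prec f h &
      mixture_independent succeq /\ mixture_independent prec].
Proof.
move=> [disj /coneP [addK scaleK] rejP] acc0 sE pE.
have hull_rej v : rej M v -> scaling_hull (rej M) v.
  by move=> Mv; exists 1, v; rewrite scale1r.
split=> [f|f|f g h|f g h|].
- by rewrite sE subrr.
- rewrite pE subrr => rej0.
  by have : (acc M `&` rej M) 0 by []; rewrite disj.
- by rewrite !sE => fg gh; rewrite -(subrKA g) [X in acc M X]addrC addrC; apply: addK.
- rewrite !pE sE => fg hg; apply: rejP; right.
  exists (f - g); first exact: hull_rej.
  by exists (h - g) => //; rewrite opprB addrA subrK.
- split; first exact: (mixture_independent_diff _ _ scaleK).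
  apply: (mixture_independent_diff (rej M)) => // a v a0 Mv.
  by apply: rejP; left; exists a, v.
Qed.

(** The model accepts the [v] with [succeq v 0] and rejects those with
    [prec v 0].  Reflexivity of acceptance is not needed here: it only serves to
    put [0] in the accepted set. *)
Lemma axioms_model (succeq prec : V -> V -> Prop) :
  (forall f, ~ prec f f) ->
  (forall f g h, succeq f g -> succeq g h -> succeq f h) ->
  (forall f g h, prec f g -> succeq h g -> prec f h) ->
  mixture_independent succeq -> mixture_independent prec ->
  model_without_confusion
    (Assessment [set v | succeq v 0] [set v | prec v 0]).
Proof.
move=> pirr strans mtrans smix pmix.
have hull_rej v : scaling_hull [set v | prec v 0] v -> prec v 0.
  move=> [a [w [a0 /= pw ->]]].
  exact: (mixture_independent_scale _ _ _ pmix a0).1.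
split=> /=.
- apply/seteqP; split=> // v [/= sv pv].
  exact: (pirr v (mtrans _ _ _ pv sv)).
- apply/coneP; split=> [u v /= su sv|a v a0 /= sv].
    apply: strans sv.
    by apply/(mixture_independent_subr0 _ _ _ smix); rewrite addrK.
  exact: (mixture_independent_scale _ _ _ smix a0).1.
- move=> _ [/hull_rej //|[u /hull_rej pu [v /= sv <-]]].
  by apply: (mixture_independent_subr0 _ u v pmix).1; apply: mtrans sv.
Qed.

End VectorSpace.

Theorem theorem3p1 (R : realType) (Omega : Type) (Omega_nonempty : inhabited Omega)
    (L : submodClosed (Omega -> R^o))
    (succeq prec : gamble L -> gamble L -> Prop) :
  (exists M : assessment (gamble L),
      [/\ model_without_confusion M,
          acc M 0 &
          forall f g : gamble L,
            (succeq f g <-> acc M (f - g)) /\ (prec f g <-> rej M (f - g))])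
  <->
  (forall (f g h : gamble L) (mu : R), 0 < mu -> mu <= 1 ->
      (* AD1 *) succeq f f /\
      (* AD2 *) ~ prec f f /\
      (* AD3 *) (succeq f g -> succeq g h -> succeq f h) /\
      (* AD4 *) (prec f g -> succeq h g -> prec f h) /\
      (* AD5 *) (succeq f g <->
                 succeq (mu *: f + (1 - mu) *: h) (mu *: g + (1 - mu) *: h)) /\
      (* AD6 *) (prec f g <->
                 prec (mu *: f + (1 - mu) *: h) (mu *: g + (1 - mu) *: h))).
Proof.
split=> [[M [Mmodel acc0 ME]] f g h mu mu0 mu1|axioms].
  have [refl irrefl strans mtrans [smix pmix]] :=
    model_axioms M succeq prec Mmodel acc0
      (fun f g => (ME f g).1) (fun f g => (ME f g).2).
  do 4![split; first by eauto].
  by split; [apply: smix | apply: pmix].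
(* The axioms that do not mention [mu] are instantiated at [mu = 1]. *)
have ax1 f g h := axioms f g h 1 ltr01 (lexx 1).
have irrefl f : ~ prec f f by case: (ax1 f f f) => _ [].
have strans f g h : succeq f g -> succeq g h -> succeq f h.
  by case: (ax1 f g h) => _ [_ []].
have mtrans f g h : prec f g -> succeq h g -> prec f h.
  by case: (ax1 f g h) => _ [_ [_ []]].
have smix : mixture_independent succeq.
  by move=> f g h mu mu0 mu1; case: (axioms f g h mu mu0 mu1) => _ [_ [_ [_ []]]].
have pmix : mixture_independent prec.
  by move=> f g h mu mu0 mu1; case: (axioms f g h mu mu0 mu1) => _ [_ [_ [_ []]]].
exists (Assessment [set v | succeq v 0] [set v | prec v 0]); split=> /=.
- exact: axioms_model.
- by case: (ax1 0 0 0).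
- by move=> f g; split; apply: mixture_independent_subr0.
Qed.
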